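(* Consider the model of the effect-free languages given by $\mathcal C=\mathbf{Set}$ and $\mathsf T$ the identity monad. Then $\mathcal V[\![e]\!]\ltimes\mathcal N[\![e]\!]$ for every source-language expression $\Gamma\vdash e:\tau$, and in particular, for every closed source-language expression $e':\mathbf{bool}$, there exists a closed CBPV value $V:\mathbf{bool}$ such that $$\mathcal V(e')\Downarrow\mathbf{return}\,V\quad\text{and}\quad\mathcal N(e')\Downarrow\mathbf{return}\,V.$$
   Context: **Source language.** Types $\tau::=\mathbf{unit}\mid\mathbf{bool}\mid\tau_1\times\tau_2\mid\tau\to\tau'$; expressions $e::=x\mid()\mid(e_1,e_2)\mid\mathbf{fst}\,e\mid\mathbf{snd}\,e\mid\mathbf{true}\mid\mathbf{false}\mid\mathbf{if}\,e_0\,\mathbf{then}\,e_1\,\mathbf{else}\,e_2\mid\lambda x{:}\tau.e\mid e\,e'$, with the usual simply typed rules $\Gamma\vdash e:\tau$. **Semantics in Set with $TX=X$.** All orders $\sqsubseteq$ on hom-sets are equality; $\eta$ and all extension operators are identities; a $\mathsf T$-algebra is just a set; $1=\{*\}$, $2=\{\mathit{true},\mathit{false}\}$. Types: $\mathcal V[\![\mathbf{unit}]\!]=\mathcal N[\![\mathbf{unit}]\!]=1$, $\mathcal V[\![\mathbf{bool}]\!]=\mathcal N[\![\mathbf{bool}]\!]=2$, products are interpreted as products of sets, $\mathcal V[\![\tau\to\tau']\!]$ is the set of functions $\mathcal V[\![\tau]\!]\to\mathcal V[\![\tau']\!]$, and $\mathcal N[\![\tau\to\tau']\!]$ the set of functions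 $\mathcal N[\![\tau]\!]\to\mathcal N[\![\tau']\!]$; contexts are products. Expressions $\Gamma\vdash e:\tau$ are interpreted, both as $\mathcal V[\![e]\!]:\mathcal V[\![\Gamma]\!]\to\mathcal V[\![\tau]\!]$ and as $\mathcal N[\![e]\!]:\mathcal N[\![\Gamma]\!]\to\mathcal N[\![\tau]\!]$, by the standard set-theoretic semantics of the simply typed $\lambda$-calculus with products and booleans (to which the general call-by-value and call-by-name semantics reduce for the identity monad). **The relations.** For functions $f^v:W\to\mathcal V[\![\tau]\!]$, $f^n:W\to\mathcal N[\![\tau]\!]$ ($W$ a set), $f^v\,\mathcal R[\![\tau]\!]_W\,f^n$ is defined by induction on $\tau$: for $\tau\in\{\mathbf{unit},\mathbf{bool}\}$, iff $f^v=f^n$; for $\tau_1\times\tau_2$, iff $(\pi_i\circ f^v)\,\mathcal R[\![\tau_i]\!]_W\,(\pi_i\circ f^n)$ for $i=1,2$; for $\tau\to\tau'$, iff for all sets $W'$, functions $w:W'\to W$, $g^v:W'\to\mathcal V[\![\tau]\!]$, $g^n:W'\to\mathcal N[\![\tau]\!]$, $g^v\,\mathcal R[\![\tau]\!]_{W'}\,g^n$ implies $(\mathrm{ev}\circ\langle f^v\circ w,g^v\rangle)\,\mathcal R[\![\tau']\!]_{W'}\,(\mathrm{ev}\circ\langle f^n\circ w,g^n\rangle)$, with $\mathrm{ev}$ function evaluation. For $\Gamma=x_1:\tau_1,\dots,x_k:\tau_k$, $g^v:\mathcal V[\![\Gamma]\!]\to\mathcal V[\![\tau]\!]$, $g^n:\mathcal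 N[\![\Gamma]\!]\to\mathcal N[\![\tau]\!]$, write $g^v\ltimes g^n$ if for all sets $W$ and families $f_i^v:W\to\mathcal V[\![\tau_i]\!]$, $f_i^n:W\to\mathcal N[\![\tau_i]\!]$ with $f_i^v\,\mathcal R[\![\tau_i]\!]_W\,f_i^n$ for all $i$, we have $(g^v\circ\langle f_i^v\rangle_i)\,\mathcal R[\![\tau]\!]_W\,(g^n\circ\langle f_i^n\rangle_i)$. **Call-by-push-value (CBPV).** Value types $A::=\mathbf{unit}\mid A_1\times A_2\mid\mathbf{bool}\mid\mathbf U\,\underline C$; computation types $\underline C::=\underline C_1\underline\times\,\underline C_2\mid A\to\underline C\mid\mathbf F A$. Values $V::=x\mid()\mid(V_1,V_2)\mid\mathbf{true}\mid\mathbf{false}\mid\mathbf{thunk}\,M$. Computations $M::=\lambda\{1.M_1,2.M_2\}\mid 1\text{`}M\mid2\text{`}M\mid\lambda x{:}A.M\mid V\text{`}M\mid\mathbf{return}\,V\mid M\,\mathbf{to}\,x.\,N\mid\mathbf{match}\,V\,\mathbf{with}\,(x_1,x_2).M\mid\mathbf{if}\,V\,\mathbf{then}\,M_1\,\mathbf{else}\,M_2\mid\mathbf{force}\,V$. Typing: values $\Gamma\vdash V:A$ are typed in the evident way, with $\mathbf{thunk}\,M:\mathbf U\underline C$ if $M:\underline C$; for computations, $\lambda\{1.M_1,2.M_2\}:\underline C_1\underline\times\,\underline C_2$ if $M_i:\underline C_i$; $i\text{`}M:\underline C_i$ if $M:\underline C_1\underline\times\,\underline C_2$; $\lambda x{:}A.M:A\to\underline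 C$ if $M:\underline C$ assuming $x:A$; $V\text{`}M:\underline C$ if $V:A$, $M:A\to\underline C$; $\mathbf{return}\,V:\mathbf FA$ if $V:A$; $M\,\mathbf{to}\,x.N:\underline C$ if $M:\mathbf FA$ and $N:\underline C$ assuming $x:A$; match and if are the evident eliminators of $A_1\times A_2$ and $\mathbf{bool}$ into any $\underline C$; $\mathbf{force}\,V:\underline C$ if $V:\mathbf U\underline C$. Big-step evaluation $M\Downarrow R$ on closed well-typed computations is generated by: $R\Downarrow R$ for $R$ of the form $\lambda\{1.M_1,2.M_2\}$, $\lambda x{:}A.M$, or $\mathbf{return}\,V$; $i\text{`}M\Downarrow R$ if $M\Downarrow\lambda\{1.N_1,2.N_2\}$ and $N_i\Downarrow R$; $V\text{`}M\Downarrow R$ if $M\Downarrow\lambda x{:}A.N$ and $N[x\mapsto V]\Downarrow R$; $M\,\mathbf{to}\,x.N\Downarrow R$ if $M\Downarrow\mathbf{return}\,V$ and $N[x\mapsto V]\Downarrow R$; $\mathbf{if}\,\mathbf{true}\,\mathbf{then}\,M_1\,\mathbf{else}\,M_2\Downarrow R$ if $M_1\Downarrow R$; $\mathbf{if}\,\mathbf{false}\,\mathbf{then}\,M_1\,\mathbf{else}\,M_2\Downarrow R$ if $M_2\Downarrow R$; $\mathbf{match}\,(V_1,V_2)\,\mathbf{with}\,(x_1,x_2).M\Downarrow R$ if $M[x_1\mapsto V_1,x_2\mapsto V_2]\Downarrow R$; $\mathbf{force}(\mathbf{thunk}\,M)\Downarrow R$ if $M\Downarrow R$. **Call-by-value translation.**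 $\mathcal V(\mathbf{unit})=\mathbf{unit}$, $\mathcal V(\mathbf{bool})=\mathbf{bool}$, $\mathcal V(\tau_1\times\tau_2)=\mathcal V(\tau_1)\times\mathcal V(\tau_2)$, $\mathcal V(\tau\to\tau')=\mathbf U(\mathcal V(\tau)\to\mathbf F\mathcal V(\tau'))$. For $\Gamma\vdash e:\tau$, the computation $\mathcal V(e):\mathbf F\mathcal V(\tau)$ (in the context with $x_i:\mathcal V(\tau_i)$): $x\mapsto\mathbf{return}\,x$; $()\mapsto\mathbf{return}\,()$; $(e_1,e_2)\mapsto\mathcal V(e_1)\,\mathbf{to}\,z_1.\,\mathcal V(e_2)\,\mathbf{to}\,z_2.\,\mathbf{return}\,(z_1,z_2)$; $\mathbf{fst}\,e\mapsto\mathcal V(e)\,\mathbf{to}\,z.\,\mathbf{match}\,z\,\mathbf{with}\,(z_1,z_2).\mathbf{return}\,z_1$, similarly $\mathbf{snd}$; $\mathbf{true}\mapsto\mathbf{return}\,\mathbf{true}$, $\mathbf{false}\mapsto\mathbf{return}\,\mathbf{false}$; $\mathbf{if}\,e_0\,\mathbf{then}\,e_1\,\mathbf{else}\,e_2\mapsto\mathcal V(e_0)\,\mathbf{to}\,z.\,\mathbf{if}\,z\,\mathbf{then}\,\mathcal V(e_1)\,\mathbf{else}\,\mathcal V(e_2)$; $\lambda x{:}\tau.e\mapsto\mathbf{return}\,\mathbf{thunk}\,\lambda x{:}\mathcal V(\tau).\mathcal V(e)$; $e\,e'\mapsto\mathcal V(e)\,\mathbf{to}\,y.\,\mathcal V(e')\,\mathbf{to}\,z.\,z\text{`}\mathbf{force}\,y$.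 **Call-by-name translation.** $\mathcal N(\mathbf{unit})=\mathbf F\,\mathbf{unit}$, $\mathcal N(\mathbf{bool})=\mathbf F\,\mathbf{bool}$, $\mathcal N(\tau_1\times\tau_2)=\mathcal N(\tau_1)\underline\times\,\mathcal N(\tau_2)$, $\mathcal N(\tau\to\tau')=\mathbf U\mathcal N(\tau)\to\mathcal N(\tau')$. For $\Gamma\vdash e:\tau$, the computation $\mathcal N(e):\mathcal N(\tau)$ (in the context with $x_i:\mathbf U\mathcal N(\tau_i)$): $x\mapsto\mathbf{force}\,x$; $()\mapsto\mathbf{return}\,()$; $(e_1,e_2)\mapsto\lambda\{1.\mathcal N(e_1),2.\mathcal N(e_2)\}$; $\mathbf{fst}\,e\mapsto1\text{`}\mathcal N(e)$; $\mathbf{snd}\,e\mapsto2\text{`}\mathcal N(e)$; $\mathbf{true}\mapsto\mathbf{return}\,\mathbf{true}$, $\mathbf{false}\mapsto\mathbf{return}\,\mathbf{false}$; $\mathbf{if}\,e_0\,\mathbf{then}\,e_1\,\mathbf{else}\,e_2\mapsto\mathcal N(e_0)\,\mathbf{to}\,z.\,\mathbf{if}\,z\,\mathbf{then}\,\mathcal N(e_1)\,\mathbf{else}\,\mathcal N(e_2)$; $\lambda x{:}\tau.e\mapsto\lambda x{:}\mathbf U\mathcal N(\tau).\mathcal N(e)$; $e\,e'\mapsto(\mathbf{thunk}\,\mathcal N(e'))\text{`}\mathcal N(e)$. (Auxiliary variables are fresh.) *)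

(* Defs.v *)
From Stdlib Require Import List.
Import ListNotations.

(** * Variables

    Terms are intrinsically typed with de Bruijn variables: an inhabitant of
    [exp Γ t] is an expression [e] together with a derivation of [Γ ⊢ e : t].
    Terms are thus taken up to α-equivalence, and a context is the list of the
    types of its variables, the most recently bound one first. *)

Inductive var {A : Set} : list A -> A -> Set :=
| vz {Γ : list A} {a : A} : var (a :: Γ) a
| vs {Γ : list A} {a b : A} : var Γ a -> var (b :: Γ) a.

Fixpoint var_map {A B : Set} (f : A -> B) {Γ : list A} {a : A} (x : var Γ a) :
    var (map f Γ) (f a) :=
  match x with
  | vz => vz
  | vs y => vs (var_map f y)
  end.

(** * Source language *)

Inductive ty : Set :=
| TUnit : ty
| TBool : ty
| TProd : ty -> ty -> ty
| TArr : ty -> ty -> ty.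

Inductive exp : list ty -> ty -> Set :=
| EVar {Γ t} : var Γ t -> exp Γ t
| EUnit {Γ} : exp Γ TUnit
| EPair {Γ t1 t2} : exp Γ t1 -> exp Γ t2 -> exp Γ (TProd t1 t2)
| EFst {Γ t1 t2} : exp Γ (TProd t1 t2) -> exp Γ t1
| ESnd {Γ t1 t2} : exp Γ (TProd t1 t2) -> exp Γ t2
| ETrue {Γ} : exp Γ TBool
| EFalse {Γ} : exp Γ TBool
| EIf {Γ t} : exp Γ TBool -> exp Γ t -> exp Γ t -> exp Γ t
| ELam {Γ t t'} : exp (t :: Γ) t' -> exp Γ (TArr t t')
| EApp {Γ t t'} : exp Γ (TArr t t') -> exp Γ t -> exp Γ t'.

(** * Semantics in sets, for the identity monad

    The call-by-value semantics (suffix [V]) and the call-by-name semantics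
    (suffix [N]) are kept as separate definitions, although for the identity
    monad their clauses coincide. *)

Fixpoint semV (t : ty) : Type :=
  match t with
  | TUnit => unit
  | TBool => bool
  | TProd t1 t2 => semV t1 * semV t2
  | TArr t t' => semV t -> semV t'
  end.

Fixpoint semN (t : ty) : Type :=
  match t with
  | TUnit => unit
  | TBool => bool
  | TProd t1 t2 => semN t1 * semN t2
  | TArr t t' => semN t -> semN t'
  end.

(** The product of the sets [X t], for [t] in [Γ]. *)
Fixpoint env (X : ty -> Type) (Γ : list ty) : Type :=
  match Γ with
  | [] => unit
  | t :: Γ' => env X Γ' * X t
  end.

Fixpoint proj {X : ty -> Type} {Γ : list ty} {t : ty} (x : var Γ t) :
    env X Γ -> X t :=
  match x in var Γ t return env X Γ -> X t with
  | vz => fun ρ => snd ρ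
  | vs y => fun ρ => proj y (fst ρ)
  end.

Fixpoint tuple {X : ty -> Type} {W : Type} {Γ : list ty} :
    (forall t, var Γ t -> W -> X t) -> W -> env X Γ :=
  match Γ return (forall t, var Γ t -> W -> X t) -> W -> env X Γ with
  | [] => fun _ _ => tt
  | t :: _ => fun f w => (tuple (fun t' x => f t' (vs x)) w, f t vz w)
  end.

Fixpoint denV {Γ : list ty} {t : ty} (e : exp Γ t) : env semV Γ -> semV t :=
  match e in exp Γ t return env semV Γ -> semV t with
  | EVar x => fun ρ => proj x ρ
  | EUnit => fun _ => tt
  | EPair e1 e2 => fun ρ => (denV e1 ρ, denV e2 ρ)
  | EFst e => fun ρ => fst (denV e ρ)
  | ESnd e => fun ρ => snd (denV e ρ)
  | ETrue => fun _ => true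
  | EFalse => fun _ => false
  | EIf e0 e1 e2 => fun ρ => if denV e0 ρ : bool then denV e1 ρ else denV e2 ρ
  | ELam e => fun ρ a => denV e (ρ, a)
  | EApp e e' => fun ρ => denV e ρ (denV e' ρ)
  end.

Fixpoint denN {Γ : list ty} {t : ty} (e : exp Γ t) : env semN Γ -> semN t :=
  match e in exp Γ t return env semN Γ -> semN t with
  | EVar x => fun ρ => proj x ρ
  | EUnit => fun _ => tt
  | EPair e1 e2 => fun ρ => (denN e1 ρ, denN e2 ρ)
  | EFst e => fun ρ => fst (denN e ρ)
  | ESnd e => fun ρ => snd (denN e ρ)
  | ETrue => fun _ => true
  | EFalse => fun _ => false
  | EIf e0 e1 e2 => fun ρ => if denN e0 ρ : bool then denN e1 ρ else denN e2 ρ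
  | ELam e => fun ρ a => denN e (ρ, a)
  | EApp e e' => fun ρ => denN e ρ (denN e' ρ)
  end.

(** * The relations between call-by-value and call-by-name *)

Fixpoint rel (t : ty) : forall W : Type, (W -> semV t) -> (W -> semN t) -> Prop :=
  match t return forall W : Type, (W -> semV t) -> (W -> semN t) -> Prop with
  | TUnit => fun W fv fn => fv = fn
  | TBool => fun W fv fn => fv = fn
  | TProd t1 t2 => fun W fv fn =>
      rel t1 W (fun w => fst (fv w)) (fun w => fst (fn w)) /\
      rel t2 W (fun w => snd (fv w)) (fun w => snd (fn w))
  | TArr t t' => fun W fv fn =>
      forall (W' : Type) (w : W' -> W) (gv : W' -> semV t) (gn : W' -> semN t),
        rel t W' gv gn ->
        rel t' W' (fun w' => fv (w w') (gv w')) (fun w' => fn (w w') (gn w'))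
  end.

(** The relation [gv ⋉ gn]. *)
Definition ltimes {Γ : list ty} {t : ty}
    (gv : env semV Γ -> semV t) (gn : env semN Γ -> semN t) : Prop :=
  forall (W : Type)
         (fv : forall t', var Γ t' -> W -> semV t')
         (fn : forall t', var Γ t' -> W -> semN t'),
    (forall t' (x : var Γ t'), rel t' W (fv t' x) (fn t' x)) ->
    rel t W (fun w => gv (tuple fv w)) (fun w => gn (tuple fn w)).

(** * Call-by-push-value *)

Inductive vty : Set :=
| VUnit : vty
| VProd : vty -> vty -> vty
| VBool : vty
| U : cty -> vty
with cty : Set :=
| CProd : cty -> cty -> cty
| CArr : vty -> cty -> cty
| F : vty -> cty.

(** In [match V with (x1, x2). M], the body [M] has [x1] as variable 1 and [x2]
    as variable 0.  The argument comes first in [CApp], as in [V ` M]. *)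
Inductive val : list vty -> vty -> Set :=
| Var {Γ A} : var Γ A -> val Γ A
| Unit {Γ} : val Γ VUnit
| Pair {Γ A1 A2} : val Γ A1 -> val Γ A2 -> val Γ (VProd A1 A2)
| VTrue {Γ} : val Γ VBool
| VFalse {Γ} : val Γ VBool
| Thunk {Γ C} : comp Γ C -> val Γ (U C)
with comp : list vty -> cty -> Set :=
| CPair {Γ C1 C2} : comp Γ C1 -> comp Γ C2 -> comp Γ (CProd C1 C2)
| CFst {Γ C1 C2} : comp Γ (CProd C1 C2) -> comp Γ C1
| CSnd {Γ C1 C2} : comp Γ (CProd C1 C2) -> comp Γ C2
| CLam {Γ A C} : comp (A :: Γ) C -> comp Γ (CArr A C)
| CApp {Γ A C} : val Γ A -> comp Γ (CArr A C) -> comp Γ C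
| Return {Γ A} : val Γ A -> comp Γ (F A)
| To {Γ A C} : comp Γ (F A) -> comp (A :: Γ) C -> comp Γ C
| Match {Γ A1 A2 C} : val Γ (VProd A1 A2) -> comp (A2 :: A1 :: Γ) C -> comp Γ C
| CIf {Γ C} : val Γ VBool -> comp Γ C -> comp Γ C -> comp Γ C
| Force {Γ C} : val Γ (U C) -> comp Γ C.

(** ** Renaming and substitution *)

Definition ren (Γ Δ : list vty) : Set := forall A, var Γ A -> var Δ A.

Definition ren_up {Γ Δ : list vty} {B : vty} (r : ren Γ Δ) : ren (B :: Γ) (B :: Δ) :=
  fun A x =>
    match x in var Γ' A return
      match Γ' with [] => Empty_set | B :: Γ => ren Γ Δ -> var (B :: Δ) A end
    with
    | vz => fun _ => vz
    | vs y => fun r => vs (r _ y)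
    end r.

Fixpoint val_ren {Γ Δ : list vty} {A : vty} (r : ren Γ Δ) (v : val Γ A) {struct v} :
    val Δ A :=
  match v in val Γ A return ren Γ Δ -> val Δ A with
  | Var x => fun r => Var (r _ x)
  | Unit => fun _ => Unit
  | Pair v1 v2 => fun r => Pair (val_ren r v1) (val_ren r v2)
  | VTrue => fun _ => VTrue
  | VFalse => fun _ => VFalse
  | Thunk m => fun r => Thunk (comp_ren r m)
  end r
with comp_ren {Γ Δ : list vty} {C : cty} (r : ren Γ Δ) (m : comp Γ C) {struct m} :
    comp Δ C :=
  match m in comp Γ C return ren Γ Δ -> comp Δ C with
  | CPair m1 m2 => fun r => CPair (comp_ren r m1) (comp_ren r m2)
  | CFst m => fun r => CFst (comp_ren r m)
  | CSnd m => fun r => CSnd (comp_ren r m)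
  | CLam m => fun r => CLam (comp_ren (ren_up r) m)
  | CApp v m => fun r => CApp (val_ren r v) (comp_ren r m)
  | Return v => fun r => Return (val_ren r v)
  | To m n => fun r => To (comp_ren r m) (comp_ren (ren_up r) n)
  | Match v m => fun r => Match (val_ren r v) (comp_ren (ren_up (ren_up r)) m)
  | CIf v m1 m2 => fun r => CIf (val_ren r v) (comp_ren r m1) (comp_ren r m2)
  | Force v => fun r => Force (val_ren r v)
  end r.

Definition weaken {Γ : list vty} {B : vty} {C : cty} (m : comp Γ C) : comp (B :: Γ) C :=
  comp_ren (fun _ x => vs x) m.

Definition sub (Γ Δ : list vty) : Set := forall A, var Γ A -> val Δ A.

Definition sub_id {Γ : list vty} : sub Γ Γ := fun _ x => Var x.

Definition sub_cons {Γ Δ : list vty} {B : vty} (v : val Δ B) (s : sub Γ Δ) :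
    sub (B :: Γ) Δ :=
  fun A x =>
    match x in var Γ' A return
      match Γ' with [] => Empty_set | B :: Γ => val Δ B -> sub Γ Δ -> val Δ A end
    with
    | vz => fun v _ => v
    | vs y => fun _ s => s _ y
    end v s.

Definition sub_up {Γ Δ : list vty} {B : vty} (s : sub Γ Δ) : sub (B :: Γ) (B :: Δ) :=
  sub_cons (Var vz) (fun A x => val_ren (fun _ y => vs y) (s A x)).

Fixpoint val_sub {Γ Δ : list vty} {A : vty} (s : sub Γ Δ) (v : val Γ A) {struct v} :
    val Δ A :=
  match v in val Γ A return sub Γ Δ -> val Δ A with
  | Var x => fun s => s _ x
  | Unit => fun _ => Unit
  | Pair v1 v2 => fun s => Pair (val_sub s v1) (val_sub s v2)
  | VTrue => fun _ => VTrue
  | VFalse => fun _ => VFalse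
  | Thunk m => fun s => Thunk (comp_sub s m)
  end s
with comp_sub {Γ Δ : list vty} {C : cty} (s : sub Γ Δ) (m : comp Γ C) {struct m} :
    comp Δ C :=
  match m in comp Γ C return sub Γ Δ -> comp Δ C with
  | CPair m1 m2 => fun s => CPair (comp_sub s m1) (comp_sub s m2)
  | CFst m => fun s => CFst (comp_sub s m)
  | CSnd m => fun s => CSnd (comp_sub s m)
  | CLam m => fun s => CLam (comp_sub (sub_up s) m)
  | CApp v m => fun s => CApp (val_sub s v) (comp_sub s m)
  | Return v => fun s => Return (val_sub s v)
  | To m n => fun s => To (comp_sub s m) (comp_sub (sub_up s) n)
  | Match v m => fun s => Match (val_sub s v) (comp_sub (sub_up (sub_up s)) m)
  | CIf v m1 m2 => fun s => CIf (val_sub s v) (comp_sub s m1) (comp_sub s m2)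
  | Force v => fun s => Force (val_sub s v)
  end s.

Definition subst1 {Γ : list vty} {A : vty} {C : cty}
    (m : comp (A :: Γ) C) (v : val Γ A) : comp Γ C :=
  comp_sub (sub_cons v sub_id) m.

(** The simultaneous substitution [m[x1 ↦ v1, x2 ↦ v2]]. *)
Definition subst2 {Γ : list vty} {A1 A2 : vty} {C : cty}
    (m : comp (A2 :: A1 :: Γ) C) (v1 : val Γ A1) (v2 : val Γ A2) : comp Γ C :=
  comp_sub (sub_cons v2 (sub_cons v1 sub_id)) m.

(** ** Big-step evaluation of closed computations *)

Inductive eval : forall {C : cty}, comp [] C -> comp [] C -> Prop :=
| ev_pair {C1 C2} (m1 : comp [] C1) (m2 : comp [] C2) :
    eval (CPair m1 m2) (CPair m1 m2)
| ev_lam {A C} (m : comp [A] C) :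
    eval (CLam m) (CLam m)
| ev_return {A} (v : val [] A) :
    eval (Return v) (Return v)
| ev_fst {C1 C2} (m : comp [] (CProd C1 C2)) n1 n2 r :
    eval m (CPair n1 n2) -> eval n1 r -> eval (CFst m) r
| ev_snd {C1 C2} (m : comp [] (CProd C1 C2)) n1 n2 r :
    eval m (CPair n1 n2) -> eval n2 r -> eval (CSnd m) r
| ev_app {A C} (v : val [] A) (m : comp [] (CArr A C)) n r :
    eval m (CLam n) -> eval (subst1 n v) r -> eval (CApp v m) r
| ev_to {A C} (m : comp [] (F A)) (n : comp [A] C) v r :
    eval m (Return v) -> eval (subst1 n v) r -> eval (To m n) r
| ev_if_true {C} (m1 m2 : comp [] C) r :
    eval m1 r -> eval (CIf VTrue m1 m2) r
| ev_if_false {C} (m1 m2 : comp [] C) r :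
    eval m2 r -> eval (CIf VFalse m1 m2) r
| ev_match {A1 A2 C} (v1 : val [] A1) (v2 : val [] A2) (m : comp [A2; A1] C) r :
    eval (subst2 m v1 v2) r -> eval (Match (Pair v1 v2) m) r
| ev_force {C} (m : comp [] C) r :
    eval m r -> eval (Force (Thunk m)) r.

(** * Call-by-value translation *)

Fixpoint tyV (t : ty) : vty :=
  match t with
  | TUnit => VUnit
  | TBool => VBool
  | TProd t1 t2 => VProd (tyV t1) (tyV t2)
  | TArr t t' => U (CArr (tyV t) (F (tyV t')))
  end.

Definition ctxV (Γ : list ty) : list vty := map tyV Γ.

Fixpoint transV {Γ : list ty} {t : ty} (e : exp Γ t) : comp (ctxV Γ) (F (tyV t)) :=
  match e in exp Γ t return comp (ctxV Γ) (F (tyV t)) with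
  | EVar x => Return (Var (var_map tyV x))
  | EUnit => Return Unit
  | EPair e1 e2 =>
      To (transV e1) (To (weaken (transV e2)) (Return (Pair (Var (vs vz)) (Var vz))))
  | EFst e => To (transV e) (Match (Var vz) (Return (Var (vs vz))))
  | ESnd e => To (transV e) (Match (Var vz) (Return (Var vz)))
  | ETrue => Return VTrue
  | EFalse => Return VFalse
  | EIf e0 e1 e2 =>
      To (transV e0) (CIf (Var vz) (weaken (transV e1)) (weaken (transV e2)))
  | ELam e => Return (Thunk (CLam (transV e)))
  | EApp e e' =>
      To (transV e) (To (weaken (transV e')) (CApp (Var vz) (Force (Var (vs vz)))))
  end.

(** * Call-by-name translation *)

Fixpoint tyN (t : ty) : cty :=
  match t with
  | TUnit => F VUnit
  | TBool => F VBool
  | TProd t1 t2 => CProd (tyN t1) (tyN t2)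
  | TArr t t' => CArr (U (tyN t)) (tyN t')
  end.

Definition ctxN (Γ : list ty) : list vty := map (fun t => U (tyN t)) Γ.

Fixpoint transN {Γ : list ty} {t : ty} (e : exp Γ t) : comp (ctxN Γ) (tyN t) :=
  match e in exp Γ t return comp (ctxN Γ) (tyN t) with
  | EVar x => Force (Var (var_map (fun t => U (tyN t)) x))
  | EUnit => Return Unit
  | EPair e1 e2 => CPair (transN e1) (transN e2)
  | EFst e => CFst (transN e)
  | ESnd e => CSnd (transN e)
  | ETrue => Return VTrue
  | EFalse => Return VFalse
  | EIf e0 e1 e2 =>
      To (transN e0) (CIf (Var vz) (weaken (transN e1)) (weaken (transN e2)))
  | ELam e => CLam (transN e)
  | EApp e e' => CApp (Thunk (transN e')) (transN e)
  end.

(* Main.v *)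
(** The relations between call-by-value and call-by-name hold of the two
    denotations by induction on expressions.  The statement about evaluation
    follows by adequacy: two logical relations between closed CBPV terms and
    set-theoretic denotations show that both translations of a closed boolean
    expression return the boolean it denotes, and at type [bool] the relation
    says that the two denotations coincide. *)

Require Import Defs.
From Stdlib Require Import List FunctionalExtensionality.
Import ListNotations.

(** * The relations between call-by-value and call-by-name *)

(** Kripke monotonicity. At arrow types it is immediate because the relation quantifies over all
    reindexings, so a further map is absorbed by composition. *)
Lemma rel_comp (t : ty) (W W' : Type) (w : W' -> W) (fv : W -> semV t) (fn : W -> semN t) :
  rel t W fv fn -> rel t W' (fun w' => fv (w w')) (fun w' => fn (w w')).
Proof.
  revert W W' w fv fn; induction t as [| |t1 IH1 t2 IH2|t IH t' IH']; simpl;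
    intros W W' w fv fn H.
  - now rewrite H.
  - now rewrite H.
  - destruct H as [H1 H2]; split.
    + exact (IH1 _ _ w _ _ H1).
    + exact (IH2 _ _ w _ _ H2).
  - intros W'' w' gv gn Hg.
    exact (H W'' (fun x => w (w' x)) gv gn Hg).
Qed.

(** A pointwise conditional commutes with projections and with application, so the claim descends to
    the component and result types. One condition [b] governs both sides. *)
Lemma rel_if (t : ty) (W : Type) (b : W -> bool) (fv gv : W -> semV t) (fn gn : W -> semN t) :
  rel t W fv fn -> rel t W gv gn ->
  rel t W (fun w => if b w then fv w else gv w) (fun w => if b w then fn w else gn w).
Proof.
  (* [h] may depend on the point [w], since at arrow types it is application to an argument varying
     with the point. *)
  assert (push : forall (W X Y : Type) (h : W -> X -> Y) (b : W -> bool) (f g : W -> X),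
    (fun w => h w (if b w then f w else g w)) =
    (fun w => if b w then h w (f w) else h w (g w))).
  { intros V X Y h c f g; apply functional_extensionality; intros w; now destruct (c w). }
  revert W b fv gv fn gn; induction t as [| |t1 IH1 t2 IH2|t IH t' IH']; simpl;
    intros W b fv gv fn gn Hf Hg.
  - now rewrite Hf, Hg.
  - now rewrite Hf, Hg.
  - destruct Hf as [Hf1 Hf2], Hg as [Hg1 Hg2].
    rewrite !(push _ _ _ (fun _ => fst)), !(push _ _ _ (fun _ => snd)); auto.
  - intros W' w av an Ha.
    rewrite (push _ _ _ (fun w' h => h (av w'))), (push _ _ _ (fun w' h => h (an w'))).
    apply IH'; auto.
Qed.

Lemma proj_tuple {X : ty -> Type} {W : Type} {Γ : list ty} {t : ty} (x : var Γ t)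
    (f : forall t, var Γ t -> W -> X t) :
  (fun w => proj x (tuple f w)) = f t x.
Proof.
  induction x as [|Γ a b x IH]; simpl.
  - reflexivity.
  - exact (IH (fun t y => f t (vs y))).
Qed.

Lemma tuple_comp {X : ty -> Type} {W W' : Type} {Γ : list ty} (w : W' -> W)
    (f : forall t, var Γ t -> W -> X t) :
  tuple (fun t x w' => f t x (w w')) = (fun w' => tuple f (w w')).
Proof.
  induction Γ as [|a Γ IH]; simpl.
  - reflexivity.
  - now rewrite (IH (fun t x => f t (vs x))).
Qed.

(** Dependent elimination in a nonempty context: the return type matches on the context, and [P] is
    passed as an argument so that it can mention the refined index. It is transparent, hence
    families built with it compute on [vz] and [vs]. *)
Definition var_case {A : Set} {Γ : list A} {b : A} (P : forall a, var (b :: Γ) a -> Type)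
    (Pz : P b vz) (Ps : forall a (y : var Γ a), P a (vs y)) (a : A) (x : var (b :: Γ) a) :
    P a x :=
  match x in var Γ' a return
    match Γ' as Γ' return var Γ' a -> Type with
    | [] => fun _ => unit
    | b :: Γ => fun x => forall P : (forall a, var (b :: Γ) a -> Type),
        P b vz -> (forall a (y : var Γ a), P a (vs y)) -> P a x
    end x
  with
  | vz => fun _ Pz _ => Pz
  | vs y => fun _ _ Ps => Ps _ y
  end P Pz Ps.

Definition var_nil {A : Set} (P : forall a, var (@nil A) a -> Prop) (a : A) (x : var [] a) :
    P a x :=
  match x in var Γ a return
    match Γ return var Γ a -> Prop with [] => P a | _ => fun _ => True end x
  with
  | vz => I
  | vs _ => I
  end.

Lemma ltimes_den {Γ : list ty} {t : ty} (e : exp Γ t) : ltimes (denV e) (denN e).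
Proof.
  induction e as [Γ t x|Γ|Γ t1 t2 e1 IH1 e2 IH2|Γ t1 t2 e IH|Γ t1 t2 e IH|Γ|Γ
    |Γ t e0 IH0 e1 IH1 e2 IH2|Γ t t' e IH|Γ t t' e IH e' IH'];
    intros W fv fn Hf; simpl.
  - rewrite !proj_tuple; apply Hf.
  - reflexivity.
  - split; [exact (IH1 W fv fn Hf)|exact (IH2 W fv fn Hf)].
  - exact (proj1 (IH W fv fn Hf)).
  - exact (proj2 (IH W fv fn Hf)).
  - reflexivity.
  - reflexivity.
  (* At [TBool] the relation is equality of functions, so the call-by-value condition can be
     replaced by the call-by-name one; [rel_if] then applies with a single condition. *)
  - pose proof (IH0 W fv fn Hf) as H0; simpl in H0.
    pose proof (f_equal (fun b w => if b w : bool then denV e1 (tuple fv w)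
                                    else denV e2 (tuple fv w)) H0) as E.
    simpl in E; rewrite E.
    apply (rel_if t W (fun w => denN e0 (tuple fn w)));
      [exact (IH1 W fv fn Hf)|exact (IH2 W fv fn Hf)].
  - intros W' w gv gn Hg.
    (* The families for the extended context: the bound variable receives the new argument, and the
       older ones are reindexed along [w]. *)
    set (fv' := var_case (fun t _ => W' -> semV t) gv (fun t y w' => fv t y (w w'))).
    set (fn' := var_case (fun t _ => W' -> semN t) gn (fun t y w' => fn t y (w w'))).
    assert (Hf' : forall t'' (x : var (t :: Γ) t''), rel t'' W' (fv' t'' x) (fn' t'' x)).
    { apply (var_case (fun t'' x => rel t'' W' (fv' t'' x) (fn' t'' x))); simpl.
      - exact Hg.
      - intros a y; apply rel_comp, Hf. }
    specialize (IH W' fv' fn' Hf'); simpl in IH.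
    now rewrite (tuple_comp w fv), (tuple_comp w fn) in IH.
  (* Application uses the arrow clause at the identity reindexing. *)
  - exact (IH W fv fn Hf W (fun w => w) _ _ (IH' W fv fn Hf)).
Qed.

(** * Renaming and substitution *)

Scheme val_comp_ind := Induction for val Sort Prop
  with comp_val_ind := Induction for comp Sort Prop.

Combined Scheme val_comp_mutind from val_comp_ind, comp_val_ind.

Lemma var_cons_ext {T : vty -> Set} {Γ : list vty} {B : vty} (f g : forall A, var (B :: Γ) A -> T A) :
  f B vz = g B vz -> (forall A (y : var Γ A), f A (vs y) = g A (vs y)) -> f = g.
Proof.
  intros Hz Hs.
  apply functional_extensionality_dep; intros A.
  apply functional_extensionality; intros x.
  exact (var_case (fun A x => f A x = g A x) Hz Hs A x).
Qed.

(* Mutual induction for the composition laws. Under a binder the induction hypothesis composes two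
   lifted maps, and [up] turns this into the lift of the composite; it is repeated because [Match]
   lifts twice. *)
Tactic Notation "push_through" uconstr(up) :=
  apply val_comp_mutind; intros; simpl; f_equal; auto;
  match goal with H : context [_ = _] |- _ => rewrite H; now rewrite !up end.

Lemma ren_up_comp {Γ Δ Θ : list vty} {B : vty} (r : ren Γ Δ) (r' : ren Δ Θ) :
  (fun A (x : var (B :: Γ) A) => ren_up r' A (ren_up r A x)) =
  ren_up (fun A x => r' A (r A x)).
Proof. now apply var_cons_ext. Qed.

(** First of four composition laws. The earlier ones supply the facts about lifted substitutions on
    which the later ones rest, ending with [sub_sub]. *)
Lemma ren_ren :
  (forall Γ A (v : val Γ A) Δ Θ (r : ren Γ Δ) (r' : ren Δ Θ),
     val_ren r' (val_ren r v) = val_ren (fun A x => r' A (r A x)) v) /\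
  (forall Γ C (m : comp Γ C) Δ Θ (r : ren Γ Δ) (r' : ren Δ Θ),
     comp_ren r' (comp_ren r m) = comp_ren (fun A x => r' A (r A x)) m).
Proof.
  push_through ren_up_comp.
Qed.

Lemma sub_up_ren {Γ Δ Θ : list vty} {B : vty} (r : ren Γ Δ) (s : sub Δ Θ) :
  (fun A (x : var (B :: Γ) A) => sub_up s A (ren_up r A x)) =
  sub_up (fun A x => s A (r A x)).
Proof. now apply var_cons_ext. Qed.

Lemma sub_ren :
  (forall Γ A (v : val Γ A) Δ Θ (r : ren Γ Δ) (s : sub Δ Θ),
     val_sub s (val_ren r v) = val_sub (fun A x => s A (r A x)) v) /\
  (forall Γ C (m : comp Γ C) Δ Θ (r : ren Γ Δ) (s : sub Δ Θ),
     comp_sub s (comp_ren r m) = comp_sub (fun A x => s A (r A x)) m).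
Proof.
  push_through sub_up_ren.
Qed.

Lemma ren_sub_up {Γ Δ Θ : list vty} {B : vty} (s : sub Γ Δ) (r : ren Δ Θ) :
  (fun A (x : var (B :: Γ) A) => val_ren (ren_up r) (sub_up s A x)) =
  sub_up (fun A x => val_ren r (s A x)).
Proof.
  apply var_cons_ext; [reflexivity|]; intros A y; simpl.
  now rewrite !(proj1 ren_ren).
Qed.

Lemma ren_sub :
  (forall Γ A (v : val Γ A) Δ Θ (s : sub Γ Δ) (r : ren Δ Θ),
     val_ren r (val_sub s v) = val_sub (fun A x => val_ren r (s A x)) v) /\
  (forall Γ C (m : comp Γ C) Δ Θ (s : sub Γ Δ) (r : ren Δ Θ),
     comp_ren r (comp_sub s m) = comp_sub (fun A x => val_ren r (s A x)) m).
Proof.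
  push_through ren_sub_up.
Qed.

Lemma sub_up_comp {Γ Δ Θ : list vty} {B : vty} (s : sub Γ Δ) (s' : sub Δ Θ) :
  (fun A (x : var (B :: Γ) A) => val_sub (sub_up s') (sub_up s A x)) =
  sub_up (fun A x => val_sub s' (s A x)).
Proof.
  apply var_cons_ext; [reflexivity|]; intros A y; simpl.
  now rewrite (proj1 sub_ren), (proj1 ren_sub).
Qed.

Lemma sub_sub :
  (forall Γ A (v : val Γ A) Δ Θ (s : sub Γ Δ) (s' : sub Δ Θ),
     val_sub s' (val_sub s v) = val_sub (fun A x => val_sub s' (s A x)) v) /\
  (forall Γ C (m : comp Γ C) Δ Θ (s : sub Γ Δ) (s' : sub Δ Θ),
     comp_sub s' (comp_sub s m) = comp_sub (fun A x => val_sub s' (s A x)) m).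
Proof.
  push_through sub_up_comp.
Qed.

Lemma sub_up_id {Γ : list vty} {B : vty} : sub_up (B := B) (@sub_id Γ) = sub_id.
Proof. now apply var_cons_ext. Qed.

Lemma sub_id_id :
  (forall Γ A (v : val Γ A), val_sub sub_id v = v) /\
  (forall Γ C (m : comp Γ C), comp_sub sub_id m = m).
Proof.
  apply val_comp_mutind; intros; simpl; rewrite ?sub_up_id; f_equal; auto.
Qed.

(** Evaluation substitutes one value at a time, while the adequacy inductions run over simultaneous
    closing substitutions; this equation passes from one to the other. *)
Lemma subst1_sub_up {Γ Δ : list vty} {B : vty} {C : cty}
    (s : sub Γ Δ) (m : comp (B :: Γ) C) (v : val Δ B) :
  subst1 (comp_sub (sub_up s) m) v = comp_sub (sub_cons v s) m.
Proof.
  unfold subst1; rewrite (proj2 sub_sub); f_equal.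
  apply var_cons_ext; [reflexivity|]; intros A y; simpl.
  rewrite (proj1 sub_ren); apply (proj1 sub_id_id).
Qed.

Lemma comp_sub_weaken {Γ Δ : list vty} {B : vty} {C : cty}
    (s : sub Γ Δ) (m : comp Γ C) (v : val Δ B) :
  comp_sub (sub_cons v s) (weaken m) = comp_sub s m.
Proof. apply (proj2 sub_ren). Qed.

Lemma eval_to {Γ : list vty} {A : vty} {C : cty} (s : sub Γ [])
    (m : comp Γ (F A)) (n : comp (A :: Γ) C) (v : val [] A) (r : comp [] C) :
  eval (comp_sub s m) (Return v) -> eval (comp_sub (sub_cons v s) n) r ->
  eval (comp_sub s (To m n)) r.
Proof.
  intros Em En; simpl; eapply ev_to; [exact Em|].
  now rewrite subst1_sub_up.
Qed.

(** * Adequacy of the call-by-value semantics *)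

(** Values do not compute, so the product and arrow clauses prescribe their shape; evaluation enters
    only through function bodies. *)
Fixpoint relV (t : ty) : val [] (tyV t) -> semV t -> Prop :=
  match t return val [] (tyV t) -> semV t -> Prop with
  | TUnit => fun _ _ => True
  | TBool => fun v d => v = if d then VTrue else VFalse
  | TProd t1 t2 => fun v d =>
      exists v1 v2, v = Pair v1 v2 /\ relV t1 v1 (fst d) /\ relV t2 v2 (snd d)
  | TArr t t' => fun v d =>
      exists m, v = Thunk (CLam m) /\
        forall a da, relV t a da ->
          exists r, eval (subst1 m a) (Return r) /\ relV t' r (d da)
  end.

(** The fundamental lemma for [relV], generalized to open expressions under related closing
    substitutions so that the induction passes under [ELam]. *)
Lemma adequacyV {Γ : list ty} {t : ty} (e : exp Γ t) :
  forall (s : sub (ctxV Γ) []) (ρ : env semV Γ),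
    (forall t' (x : var Γ t'), relV t' (s _ (var_map tyV x)) (proj x ρ)) ->
    exists r, eval (comp_sub s (transV e)) (Return r) /\ relV t r (denV e ρ).
Proof.
  induction e as [Γ t x|Γ|Γ t1 t2 e1 IH1 e2 IH2|Γ t1 t2 e IH|Γ t1 t2 e IH|Γ|Γ
    |Γ t e0 IH0 e1 IH1 e2 IH2|Γ t t' e IH|Γ t t' e IH e' IH'];
    intros s ρ Hs; cbn [transV transN].
  - eexists; split; [apply ev_return|apply Hs].
  - eexists; split; [apply ev_return|exact I].
  - destruct (IH1 s ρ Hs) as (r1 & E1 & H1), (IH2 s ρ Hs) as (r2 & E2 & H2).
    exists (Pair r1 r2); split; [|now exists r1, r2].
    eapply eval_to; [exact E1|].
    eapply eval_to; [rewrite comp_sub_weaken; exact E2|].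
    apply ev_return.
  - destruct (IH s ρ Hs) as (r & E & r1 & r2 & -> & H1 & H2).
    exists r1; split; [|exact H1].
    eapply eval_to; [exact E|].
    apply ev_match, ev_return.
  - destruct (IH s ρ Hs) as (r & E & r1 & r2 & -> & H1 & H2).
    exists r2; split; [|exact H2].
    eapply eval_to; [exact E|].
    apply ev_match, ev_return.
  - eexists; split; [apply ev_return|reflexivity].
  - eexists; split; [apply ev_return|reflexivity].
  - destruct (IH0 s ρ Hs) as (r & E & Hr); simpl in Hr.
    cbn [denV]; destruct (denV e0 ρ); subst r;
      [destruct (IH1 s ρ Hs) as (r & E' & H)|destruct (IH2 s ρ Hs) as (r & E' & H)];
      exists r; (split; [|exact H]);
      (eapply eval_to; [exact E|]); simpl;
      rewrite !comp_sub_weaken; now constructor.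
  - eexists; split; [apply ev_return|].
    eexists; split; [reflexivity|]; intros a da Ha.
    rewrite subst1_sub_up; apply IH.
    now apply var_case.
  - destruct (IH s ρ Hs) as (r & E & m & -> & Hm), (IH' s ρ Hs) as (a & E' & Ha).
    destruct (Hm _ _ Ha) as (r & Er & Hr).
    exists r; split; [|exact Hr].
    eapply eval_to; [exact E|].
    eapply eval_to; [rewrite comp_sub_weaken; exact E'|].
    eapply ev_app; [apply ev_force, ev_lam|exact Er].
Qed.

(** * Adequacy of the call-by-name semantics *)

(** Here computations are related, as call-by-name arguments are unevaluated. At the other types a
    computation is constrained only through what it evaluates to. *)
Fixpoint relN (t : ty) : comp [] (tyN t) -> semN t -> Prop :=
  match t return comp [] (tyN t) -> semN t -> Prop with
  | TUnit => fun _ _ => True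
  | TBool => fun m d => eval m (Return (if d then VTrue else VFalse))
  | TProd t1 t2 => fun m d =>
      exists m1 m2, eval m (CPair m1 m2) /\ relN t1 m1 (fst d) /\ relN t2 m2 (snd d)
  | TArr t t' => fun m d =>
      exists n, eval m (CLam n) /\
        forall a da, relN t a da -> relN t' (subst1 n (Thunk a)) (d da)
  end.

(** Case analysis suffices: each clause uses the computation itself only as the subject of an
    evaluation, if at all. *)
Lemma relN_expansion (t : ty) (m m' : comp [] (tyN t)) (d : semN t) :
  (forall r, eval m r -> eval m' r) -> relN t m d -> relN t m' d.
Proof.
  intros Hm; destruct t as [| |t1 t2|t t']; simpl.
  - trivial.
  - apply Hm.
  - intros (m1 & m2 & E & H); exists m1, m2; auto.
  - intros (n & E & H); exists n; auto.
Qed.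

Lemma adequacyN {Γ : list ty} {t : ty} (e : exp Γ t) :
  forall (s : sub (ctxN Γ) []) (ρ : env semN Γ),
    (forall t' (x : var Γ t'),
       relN t' (Force (s _ (var_map (fun t => U (tyN t)) x))) (proj x ρ)) ->
    relN t (comp_sub s (transN e)) (denN e ρ).
Proof.
  induction e as [Γ t x|Γ|Γ t1 t2 e1 IH1 e2 IH2|Γ t1 t2 e IH|Γ t1 t2 e IH|Γ|Γ
    |Γ t e0 IH0 e1 IH1 e2 IH2|Γ t t' e IH|Γ t t' e IH e' IH'];
    intros s ρ Hs; cbn [transV transN].
  - apply Hs.
  - exact I.
  - eexists _, _; split; [apply ev_pair|].
    exact (conj (IH1 s ρ Hs) (IH2 s ρ Hs)).
  - destruct (IH s ρ Hs) as (m1 & m2 & E & H1 & H2).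
    refine (relN_expansion _ _ _ _ _ H1); intros r; exact (ev_fst _ _ _ _ E).
  - destruct (IH s ρ Hs) as (m1 & m2 & E & H1 & H2).
    refine (relN_expansion _ _ _ _ _ H2); intros r; exact (ev_snd _ _ _ _ E).
  - apply ev_return.
  - apply ev_return.
  - pose proof (IH0 s ρ Hs) as E; simpl in E.
    cbn [denN]; destruct (denN e0 ρ);
      [refine (relN_expansion _ _ _ _ _ (IH1 s ρ Hs))
      |refine (relN_expansion _ _ _ _ _ (IH2 s ρ Hs))];
      intros r Hr; (eapply eval_to; [exact E|]); simpl;
      rewrite !comp_sub_weaken; now constructor.
  - eexists; split; [apply ev_lam|]; intros a da Ha.
    rewrite subst1_sub_up; apply IH.
    apply var_case; [|exact Hs].
    (* The bound variable stands for [Thunk a], and forcing it evaluates as [a] does. *)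
    refine (relN_expansion _ _ _ _ _ Ha); intros r; apply ev_force.
  - destruct (IH s ρ Hs) as (n & E & Hn).
    refine (relN_expansion _ _ _ _ _ (Hn _ _ (IH' s ρ Hs))); intros r.
    exact (ev_app _ _ _ _ E).
Qed.

Theorem corollary4p10 :
  (forall (Γ : list ty) (t : ty) (e : exp Γ t), ltimes (denV e) (denN e)) /\
  (forall e' : exp [] TBool,
     exists V : val [] VBool,
       eval (transV e') (Return V) /\ eval (transN e') (Return V)).
Proof.
  split; [exact @ltimes_den|]; intros e'.
  (* The witness is the boolean denoted by [e']; each translation returns it by its own adequacy
     lemma. *)
  exists (if denV e' tt then VTrue else VFalse); split.
  - destruct (adequacyV e' sub_id tt) as (r & E & Hr).
    { apply (var_nil (fun t x => relV t (sub_id _ (var_map tyV x)) (proj x tt))). }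
    simpl in Hr; rewrite (proj2 sub_id_id) in E; now rewrite <- Hr.
  (* For a closed expression take the one-point set with empty families: equality of the two
     functions at [tt] is equality of the denotations. *)
  - assert (H : denV e' tt = denN e' tt).
    { refine (f_equal (fun f => f tt) (ltimes_den e' unit (fun _ x _ => proj x tt)
                                         (fun _ x _ => proj x tt) _)).
      apply (var_nil (fun t x => rel t unit (fun _ => proj x tt) (fun _ => proj x tt))). }
    rewrite H, <- (proj2 sub_id_id _ _ (transN e')).
    apply (adequacyN e' sub_id tt).
    apply (var_nil (fun t x =>
      relN t (Force (sub_id _ (var_map (fun t => U (tyN t)) x))) (proj x tt))).
Qed.
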